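(* Let $n\ge 1$, let $q$ be a positive real number, and let $a_1,b_1,a_2,b_2,\ldots,a_n,b_n$ be positive integers. Define weights $w_1,\ldots,w_{2n}$ by \begin{align*} w_1 &= 1 + q + \cdots + q^{a_1 - 1}, \\ w_2 &= q^{a_1} + q^{a_1+1} + \cdots + q^{a_1+b_1-1}, \\ w_3 &= q^{a_1+b_1} + q^{a_1+b_1+1} + \cdots + q^{a_1+b_1+a_2-1}, \\ w_4 &= q^{a_1+b_1+a_2} + q^{a_1+b_1+a_2+1} + \cdots + q^{a_1+b_1+a_2+b_2-1}, \\ &\ \,\vdots \\ w_{2n} &= q^{a_1+b_1+\cdots+a_n} + \cdots + q^{a_1+b_1 + \cdots + a_n+b_n-1}; \end{align*} that is, for $1\le i\le n$, with $s_i=\sum_{j=1}^{i-1}(a_j+b_j)$, one has $w_{2i-1}=\sum_{t=0}^{a_i-1}q^{s_i+t}$ and $w_{2i}=\sum_{t=0}^{b_i-1}q^{s_i+a_i+t}$. Let $S$ be a set of $2n$ distinct integers, and let $\pi=(\pi_1,\ldots,\pi_{2n})$ be a random linear ordering of $S$ generated by process $\mathcal{W}$ with weights $w_1,\ldots,w_{2n}$. Then for every $k\in\{0,1,\ldots,n\}$, the probability that the watershed of $\pi$ is $k$ equals \[\varphi_k := \prod_{i=1}^k \frac{ q^{a_i} \left[ b_i + \sum_{j=i+1}^k (a_j + b_j)\right]_q}{\left[ \sum_{j=i}^k (a_j + b_j)\right]_q } \prod_{i=k+1}^n \frac{ \left[ a_i + \sum_{j=k+1}^{i-1} (a_j + b_j)\right]_q}{\left[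 \sum_{j=k+1}^i (a_j + b_j)\right]_q}. \]
   Context: For a positive integer $m$ and a positive real number $q$, $[m]_q := 1+q+q^2+\cdots+q^{m-1}$. Empty products are interpreted as $1$ and empty sums as $0$. A linear ordering of a finite set $S$ is a sequence $\pi_1,\ldots,\pi_{|S|}$ listing each element of $S$ exactly once. Process $\mathcal{W}$: given a finite set $S$ of integers and positive real weights $w_1,\ldots,w_{|S|}$, it generates a random linear ordering $\pi$ of $S$ as follows. Choose $i_1\in\{1,\ldots,|S|\}$ at random, where the probability of choosing $i$ is proportional to $w_i$, and let $\pi_{i_1}$ be the largest element of $S$. Next choose $i_2\in\{1,\ldots,|S|\}\setminus\{i_1\}$ at random, again choosing $i$ with probability proportional to $w_i$, and let $\pi_{i_2}$ be the second largest element of $S$. Continue in this fashion (at each step choosing among the indices not yet chosen, given the past choices, with probability proportional to the weights, and assigning to the chosen position the largest element of $S$ not yet used) until $\pi_i$ has been assigned a value for all $i$. The map $\Phi$: for a finite set $T$ of integers and a permutation $\sigma$ of $T$ (a bijection $T\to T$), write $\sigma$ in disjoint cycle notation (fixed points included as cycles of length $1$), such that in each cycle the largest element is written first, and the cycles are arranged in increasing order of their largest elements; then erase the parentheses to obtain a linear ordering $\Phi(\sigma)$ of $T$. The map $\Phi$ is a bijection from permutations of $T$ to linear orderings of $T$ (the beginnings of the cycles are the left-to-right maxima of $\Phi(\sigma)$). Watershed: for a sequence $\pi_1,\ldots,\pi_{2n}$ of $2n$ distinct integers, there exists a unique $k\in\{0,1,\ldots,n\}$ such that all the cycle lengths of both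 $\Phi^{-1}(\pi_{2k},\pi_{2k-1},\ldots,\pi_2,\pi_1)$ and $\Phi^{-1}(\pi_{2k+1},\pi_{2k+2},\ldots,\pi_{2n-1},\pi_{2n})$ are even (an empty sequence corresponds to the empty permutation, for which the condition is vacuous). This $k$ is called the watershed of the sequence. *)

(* Defs.v *)
From mathcomp Require Import all_boot all_order all_algebra all_fingroup finmap.

Set Implicit Arguments.
Unset Strict Implicit.
Unset Printing Implicit Defensive.

Import Order.TTheory GRing.Theory Num.Theory.
Local Open Scope ring_scope.

Definition qint (R : realFieldType) (q : R) (m : nat) : R := \sum_(t < m) q ^+ t.

(* Linear orderings of a finite set of integers are duplicate-free sequences;
   positions and the indices of weights are counted from 1, so that the element
   i : 'I_m stands for the position i.+1. *)

(* [fill_law w p xs s] is the probability that the partially filled ordering p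
   (None = free position), once the values xs have been placed one after the
   other, each at a free position drawn with conditional probability
   proportional to the weights, is the sequence s. *)
Fixpoint fill_law (R : realFieldType) (w : nat -> R) (m : nat)
    (p : {ffun 'I_m -> option int}) (xs s : seq int) : R :=
  if xs is x :: xs' then
    \sum_(i < m | p i == None)
      w i.+1 / (\sum_(j < m | p j == None) w j.+1)
      * fill_law w [ffun j => if j == i then Some x else p j] xs' s
  else (codom p == map Some s)%:R.

Definition processW (R : realFieldType) (S : {fset int}) (w : nat -> R)
    (s : seq int) : R :=
  @fill_law R w #|` S| [ffun=> None] (sort >=%O (enum_fset S)) s.

Definition processW_prob (R : realFieldType) (S : {fset int}) (w : nat -> R)
    (E : pred (seq int)) : R :=
  \sum_(s <- permutations (enum_fset S) | E s) processW S w s.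

Section Phi.

Variable T : {fset int}.
Implicit Type sigma : {perm T}.

Definition cycle_word sigma (x : T) : seq int :=
  [seq val y | y <- traject sigma x #|porbit sigma x|].

Definition cycle_maxima sigma : seq T :=
  sort (fun x y => val x <= val y)
    [seq x <- enum {: T} | [forall y in porbit sigma x, val y <= val x]].

Definition Phi sigma : seq int :=
  flatten [seq cycle_word sigma x | x <- cycle_maxima sigma].

Definition even_cycles sigma : bool :=
  [forall C in porbits sigma, ~~ odd #|C|].

End Phi.

(* Phi is a bijection onto the linear orderings of T, so the default value is
   irrelevant when s is duplicate-free. *)
Definition Phi_inv (s : seq int) : {perm [fset x in s]%fset} :=
  odflt 1%g [pick sigma | Phi sigma == s].

Definition watershed_at (s : seq int) (k : nat) : bool :=
  even_cycles (Phi_inv (rev (take k.*2 s))) && even_cycles (Phi_inv (drop k.*2 s)).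

(* For s duplicate-free of even size exactly one k <= (size s)./2 satisfies
   [watershed_at s]; [find] returns it. *)
Definition watershed (s : seq int) : nat :=
  find (watershed_at s) (iota 0 (size s)./2.+1).

Section Weights.

Variables (R : realFieldType) (q : R) (a b : nat -> nat).

(* w_l for l >= 1; the index i below satisfies l = 2i - 1 or l = 2i. *)
Definition weight (l : nat) : R :=
  let i := uphalf l in
  let s := (\sum_(1 <= j < i) (a j + b j))%N in
  if odd l then \sum_(t < a i) q ^+ (s + t)
  else \sum_(t < b i) q ^+ (s + a i + t).

Definition varphi (n k : nat) : R :=
  (\prod_(1 <= i < k.+1)
      (q ^+ a i * qint q (b i + \sum_(i.+1 <= j < k.+1) (a j + b j))
       / qint q (\sum_(i <= j < k.+1) (a j + b j))))
  * (\prod_(k.+1 <= i < n.+1)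
      (qint q (a i + \sum_(k.+1 <= j < i) (a j + b j))
       / qint q (\sum_(k.+1 <= j < i.+1) (a j + b j)))).

End Weights.

(* Main.v *)
Require Import Defs.
From mathcomp Require Import all_boot all_order all_algebra all_fingroup finmap.
From mathcomp Require Import zify.
Set Implicit Arguments.
Unset Strict Implicit.
Unset Printing Implicit Defensive.
Import Order.TTheory GRing.Theory Num.Theory.
Local Open Scope ring_scope.

(** The cycles of the permutation attached by Phi to a word are its blocks cut
at the left-to-right maxima.  So they are all even exactly when the word has
even length and no entry at an even position (counted from 1) is a
left-to-right maximum ([even_cycles_Phi_inv]).  Hence k is the watershed of
pi_1, ..., pi_2n if and only if
- for 1 <= i <= k, pi_(2i-1) is not the maximum of pi_(2i-1), ..., pi_2k;
- for k < i <= n, pi_(2i) is not the maximum of pi_(2k+1), ..., pi_2i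
([watershed_atP], [watershed_eq]).  Uniqueness of k is seen at the maximum of
pi_(2j+1), ..., pi_2k, where j < k: if its position is odd, a condition for k
to be the watershed fails, and if it is even, one for j does.

Each of the n conditions reads: the largest entry of a window I of positions is
not at the position x of I.  The process drops the largest entry of I into
position i of I with probability w_i / W(I), where W denotes total weight, so
the condition has probability 1 - w_x / W(I).  The windows form a laminar
family (two nested chains, disjoint from each other) in which the forbidden
position of a window lies in no smaller window, and for such a family the
conditions are independent ([fill_law_prob]).  The proof runs the process: in a
partially filled ordering, a condition whose window has been touched is already
decided, while the others still contribute their factors 1 - w_x / W(I).  That
this product is preserved by one more step is the identity [laminar_sum].

The resulting product formula [watershed_prob] holds for arbitrary positive
weights.  For the q-weights of the theorem, the total weight of a run of
consecutive positions is a power of q times a q-integer ([range_weightE]), and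
the n factors become those of phi_k ([varphiE]). *)

(** * Independence of conditions on the largest entries of laminar windows *)

(** A condition c forbids the position x c to carry the largest entry of the
window I c.  Position i : 'I_m has weight w i.+1. *)
Section Records.

Variables (R : realFieldType) (m : nat) (C : eqType).
Variables (x : C -> 'I_m) (I : C -> {set 'I_m}) (w : nat -> R).

Definition total_weight (A : {set 'I_m}) : R := \sum_(i in A) w i.+1.

(** The probability that the first position filled in I c is not x c. *)
Definition avoid_prob (c : C) : R :=
  total_weight (I c :\ x c) / total_weight (I c).

(** The probability of c given that i is the next position to be filled, when
no position of I c has been filled yet. *)
Definition first_factor (i : 'I_m) (c : C) : R :=
  if i \in I c then (i != x c)%:R else avoid_prob c.

(** The condition d may come after c in a list: its window is nested in that of
c, away from the position forbidden by c, or disjoint from it. *)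
Definition laminar : rel C := fun c d =>
  (x c \notin I d) && ((I d \subset I c) || [disjoint I d & I c]).

Lemma total_weightID (A B : {set 'I_m}) :
  total_weight A = total_weight (A :&: B) + total_weight (A :\: B).
Proof. by rewrite /total_weight (big_setID B). Qed.

(** One step of the process: averaging the products of the conditional
probabilities over the next position gives back the product of the
probabilities.  By induction on L, splitting U along the first window. *)
Lemma laminar_sum (L : seq C) (U : {set 'I_m}) :
  pairwise laminar L ->
  {in L, forall c, total_weight (I c) != 0} ->
  {in L, forall c, (I c \subset U) || [disjoint I c & U]} ->
  \sum_(i in U) w i.+1 * \prod_(c <- L) first_factor i c
    = total_weight U * \prod_(c <- L) avoid_prob c.
Proof.
elim: L U => [|c L IHL] U.
  by move=> _ _ _; rewrite big_nil mulr1; apply: eq_bigr => i _; rewrite big_nil mulr1.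
rewrite pairwise_cons => /andP[/allP cL pL] Wc cU.
have Wc0 := Wc c (mem_head _ _).
have WL : {in L, forall d, total_weight (I d) != 0}.
  by move=> d dL; apply: Wc; rewrite inE dL orbT.
have LU d : d \in L -> (I d \subset U) || [disjoint I d & U].
  by move=> dL; apply: cU; rewrite inE dL orbT.
under [LHS]eq_bigr => i _ do rewrite big_cons mulrCA.
rewrite big_cons.
have [cdU|ncdU] := boolP [disjoint I c & U].
  rewrite -mulrCA -(IHL U pL WL LU) mulr_sumr; apply: eq_bigr => i iU.
  by rewrite /first_factor (disjointFl cdU iU).
have cSU : I c \subset U.
  by have := cU c (mem_head _ _); rewrite (negPf ncdU) orbF.
(* The positions in I c decide c; outside I c, c is untouched. *)
rewrite (big_setID (I c)) (setIidPr cSU) (total_weightID U (I c)) (setIidPr cSU) mulrDl.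
congr (_ + _); last first.
  rewrite -mulrCA -IHL //.
    rewrite mulr_sumr; apply: eq_bigr => i; rewrite inE => /andP[/negPf ni _].
    by rewrite /first_factor ni.
  move=> d dL; have := LU d dL; have /andP[_] := cL d dL.
  rewrite !disjoints_subset setDE subsetI setCI setCK => h1 h2.
  case/orP: h1 => h1; first by apply/orP; right; apply: subset_trans h1 (subsetUr _ _).
  case/orP: h2 => h2; first by rewrite h2 h1.
  by apply/orP; right; apply: subset_trans h2 (subsetUl _ _).
have -> : total_weight (I c) * (avoid_prob c * \prod_(d <- L) avoid_prob d)
    = total_weight (I c :\ x c) * \prod_(d <- L) avoid_prob d.
  by rewrite mulrA /avoid_prob mulrC [_ * (_ / _)]mulrC divfK // mulrC.
rewrite -IHL //; last first.
  move=> d dL; have /andP[xd] := cL d dL.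
  rewrite subsetD1 xd andbT => /orP[->//|h].
  by rewrite disjoint_sym (disjointWl (subsetDl _ _)) ?orbT // disjoint_sym.
rewrite big_mkcond [RHS]big_mkcond; apply: eq_bigr => i _.
rewrite !inE /first_factor; case: (i \in I c); rewrite ?andbF ?andbT //.
by case: eqP => _; rewrite ?mul0r ?mul1r.
Qed.

(** No entry placed so far breaks c: the position x c is free, or its entry is
smaller than some entry already present in the window. *)
Definition respects (p : {ffun 'I_m -> option int}) (c : C) : bool :=
  if p (x c) is Some u
  then [exists j in I c, if p j is Some v then u < v else false] else true.

(** The complete ordering s satisfies c. *)
Definition avoids (s : seq int) (c : C) : bool :=
  [exists j in I c, nth 0 s (x c) < nth 0 s j].

Definition filled (p : {ffun 'I_m -> option int}) : {set 'I_m} :=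
  [set i | p i != None].

(** Probability of c given the partial ordering p, when entries are placed in
decreasing order: c is decided as soon as its window has been touched. *)
Definition factor (p : {ffun 'I_m -> option int}) (c : C) : R :=
  (respects p c)%:R * (if [disjoint I c & filled p] then avoid_prob c else 1).

Definition place (p : {ffun 'I_m -> option int}) (i : 'I_m) (v : int) :
  {ffun 'I_m -> option int} := [ffun j => if j == i then Some v else p j].

Hypothesis xI : forall c, x c \in I c.

Lemma filled_place (p : {ffun 'I_m -> option int}) (i : 'I_m) (v : int) :
  filled (place p i v) = i |: filled p.
Proof. by apply/setP => j; rewrite !inE ffunE; case: (j == i). Qed.

Lemma factor_place (p : {ffun 'I_m -> option int}) (i : 'I_m) (v : int) c :
  p i = None -> (forall (j : 'I_m) u, p j = Some u -> v < u) ->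
  factor (place p i v) c =
    if [disjoint I c & filled p] then first_factor i c else factor p c.
Proof.
move=> pi0 pv.
rewrite /factor /first_factor filled_place.
have [dis|ndis] := boolP [disjoint _ & filled p].
  have px : p (x c) = None.
    by apply/eqP; have := disjointFr dis (xI c); rewrite inE => /negbFE.
  have -> : [disjoint I c & i |: filled p] = (i \notin I c).
    by rewrite disjoints_subset setCU subsetI -!disjoints_subset dis andbT
        disjoint_sym disjoints1.
  rewrite /respects ffunE px; have [<-|nix] := eqVneq (x c) i.
    rewrite xI mulr1; congr (nat_of_bool _)%:R; apply/negbTE/existsPn => j.
    rewrite !ffunE; case: eqP => [_|_]; first by rewrite ltxx andbF.
    case: (boolP (j \in I c)) => // jI.
    by have := disjointFr dis jI; rewrite inE => /negbFE/eqP->.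
  by rewrite mul1r; case: (i \in I c).
have -> : [disjoint I c & i |: filled p] = false.
  apply: contraNF ndis => dis; rewrite disjoint_sym.
  by rewrite (disjointWl (subsetUr [set i] _)) // disjoint_sym.
rewrite !mulr1; congr (nat_of_bool _)%:R.
rewrite /respects ffunE; have [xci|nix] := eqVneq (x c) i.
  rewrite xci pi0; apply/existsP.
  have /pred0Pn[j /andP[/= jI]] := ndis.
  rewrite inE => pj; exists j; rewrite jI ffunE.
  have [ji|_] := eqVneq j i; first by rewrite ji pi0 in pj.
  by case E: (p j) pj => [u|//] _; apply: pv E.
case Ex: (p (x c)) => [u|//]; apply: eq_existsb => j; rewrite ffunE.
by case: eqP => // ->; rewrite pi0 ltNge ltW // (pv _ _ Ex).
Qed.

Hypothesis w_gt0 : forall i, (i < m)%N -> 0 < w i.+1.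

Lemma total_weight_gt0 (A : {set 'I_m}) i : i \in A -> 0 < total_weight A.
Proof.
move=> iA; rewrite /total_weight (bigD1 i) //= ltr_wpDr ?w_gt0 //.
by apply: sumr_ge0 => j _; rewrite ltW ?w_gt0.
Qed.

Lemma perm_place (p : {ffun 'I_m -> option int}) (i : 'I_m) (v : int) : p i = None ->
  perm_eq (pmap id (codom (place p i v))) (v :: pmap id (codom p)).
Proof.
move=> pi0; rewrite !codomE.
have iE : i \in enum 'I_m by rewrite mem_enum.
have := enum_uniq 'I_m; case/splitPr: iE => s1 s2.
rewrite cat_uniq /= => /and3P[_ /norP[i1 _] /andP[i2 _]].
have E s : i \notin s -> map (place p i v) s = map p s.
  by move=> ni; apply/eq_in_map => j js; rewrite ffunE; case: eqP js ni => [->->|].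
rewrite !map_cat /= !E // ffunE eqxx pi0 !pmap_cat /=.
by rewrite -cat1s perm_catCA.
Qed.

(** When entries are placed in decreasing order, the conditions of a laminar
list are independent given the partial ordering p. *)
Lemma fill_law_prob (L : seq C) :
  pairwise laminar L ->
  forall (xs t : seq int) (p : {ffun 'I_m -> option int}),
  sorted >%R xs ->
  size xs = #|~: filled p| ->
  (forall (i : 'I_m) u, p i = Some u -> all (fun v => v < u) xs) ->
  perm_eq t (pmap id (codom p) ++ xs) ->
  \sum_(s <- permutations t | all (avoids s) L) fill_law w p xs s
    = \prod_(c <- L) factor p c.
Proof.
move=> lamL; elim=> [|v xs IHxs] t p.
  move=> _ /esym/eqP; rewrite cards_eq0 => /eqP fp _; rewrite cats0 => tp.
  have pS (i : 'I_m) : exists u, p i = Some u.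
    have : i \notin ~: filled p by rewrite fp inE.
    by rewrite !inE negbK; case: (p i) => // u _; exists u.
  have cp : codom p = map Some (pmap id (codom p)).
    rewrite codomE; elim: (enum _) => //= i s {1}->.
    by have [u ->] := pS i.
  (* No position is free: p is the complete ordering s0. *)
  set s0 := pmap id (codom p) in tp cp.
  have s0E (i : 'I_m) : p i = Some (nth 0 s0 i).
    have szs0 : size s0 = m by rewrite -(size_map Some) -cp size_codom card_ord.
    have -> : p i = nth None (codom p) i.
      by rewrite codomE (nth_map i) ?nth_ord_enum // size_enum_ord.
    by rewrite cp (nth_map 0) // szs0.
  have s0t : s0 \in permutations t by rewrite mem_permutations perm_sym.
  rewrite big_mkcond (bigD1_seq s0) ?permutations_uniq //= big1 ?addr0; last first.
    move=> s ns; rewrite cp (inj_eq (inj_map (@Some_inj _))) eq_sym (negPf ns).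
    by case: ifP.
  rewrite cp eqxx.
  have -> : \prod_(c <- L) factor p c = \prod_(c <- L) (avoids s0 c)%:R.
    apply: eq_bigr => c _; rewrite /factor.
    have -> : [disjoint I c & filled p] = false.
      apply/negbTE/pred0Pn; exists (x c) => /=.
      by rewrite xI inE s0E.
    rewrite mulr1 /respects s0E; congr (nat_of_bool _)%:R.
    by apply: eq_existsb => j; rewrite s0E.
  by elim: {+}L => [|c L' IHL]; rewrite ?big_nil // big_cons -IHL /=; case: avoids;
     rewrite ?mul1r ?mul0r.
rewrite /= path_sortedE; last by move=> a b c ba ac; apply: lt_trans ac ba.
case/andP=> /allP vxs sxs szxs pxs tp.
have free_n0 : \sum_(j < m | p j == None) w j.+1 != 0.
  have /card_gt0P[j jf] : (0 < #|~: filled p|)%N by rewrite -szxs.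
  have := total_weight_gt0 jf; rewrite lt_def => /andP[+ _].
  by rewrite /total_weight; under eq_bigl do rewrite !inE negbK.
rewrite exchange_big /=.
have IH (i : 'I_m) : p i = None ->
    \sum_(s <- permutations t | all (avoids s) L) fill_law w (place p i v) xs s
    = \prod_(c <- L) factor (place p i v) c.
  move=> pi0; apply: IHxs => //.
  - apply/succn_inj; rewrite szxs filled_place setCU setIC -setDE.
    by rewrite [LHS](cardsD1 i) !inE pi0 eqxx.
  - move=> j u; rewrite ffunE; case: eqP => [_ [<-]|_ /pxs /andP[]//].
    exact/allP.
  - apply: perm_trans tp _; rewrite perm_sym.
    apply: perm_trans (perm_cat (perm_place v pi0) (perm_refl xs)) _.
    by rewrite -cat1s -catA perm_catCA.
(* Conditions with a touched window keep their status, and the others go from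
   avoid_prob to first_factor. *)
transitivity (\sum_(i in ~: filled p) w i.+1 / (\sum_(j < m | p j == None) w j.+1)
    * ((\prod_(c <- [seq c <- L | [disjoint I c & filled p]]) first_factor i c)
    * \prod_(c <- L | ~~ [disjoint I c & filled p]) factor p c)).
  apply: eq_big => [i|i /eqP pi0]; first by rewrite !inE negbK.
  rewrite -mulr_sumr (IH i pi0) big_filter (bigID (fun c => [disjoint I c & filled p])).
  by congr (_ * (_ * _)); apply: eq_bigr => c dc;
    (rewrite factor_place // => [|j u /pxs/andP[]//]); case: ifP dc.
have free_sum : \sum_(j < m | p j == None) w j.+1 = total_weight (~: filled p).
  by apply: eq_bigl => j; rewrite !inE negbK.
set V := \sum_(j < m | _) _ in free_n0 free_sum *.
set K := \prod_(c <- L | _) factor p c.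
transitivity (\sum_(i in ~: filled p) w i.+1 *
   (\prod_(c <- [seq c <- L | [disjoint I c & filled p]]) first_factor i c) * (K / V)).
  by apply: eq_bigr => i _; rewrite -!mulrA; congr (_ * _); rewrite mulrCA;
    congr (_ * _); rewrite mulrC.
rewrite -mulr_suml laminar_sum ?pairwise_filter //.
- rewrite -free_sum [K / V]mulrC mulrACA mulfV // mul1r.
  rewrite [RHS](bigID (fun c => [disjoint I c & filled p])) /= -/K big_filter.
  congr (_ * _); apply: eq_bigr => c dc; rewrite /factor dc /respects.
  have := disjointFr dc (xI c); rewrite inE => /negbFE/eqP->.
  by rewrite mul1r.
- by move=> c _; have := total_weight_gt0 (xI c); rewrite lt_def => /andP[].
- by move=> c; rewrite mem_filter => /andP[dc _]; rewrite -disjoints_subset dc.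
Qed.
End Records.

(** * Record blocks and the bijection Phi *)

(** A nonempty word whose first entry is its strict maximum. *)
Definition record_block (B : seq int) : bool :=
  if B is h :: t then all (fun v => v < h) t else false.

(** The decomposition of a word into blocks that begin at its left-to-right
maxima. *)
Definition record_decomp (Bs : seq (seq int)) : bool :=
  all record_block Bs && pairwise (fun B B' => head 0 B < head 0 B') Bs.

Lemma record_decomp_inj Bs Cs :
  record_decomp Bs -> record_decomp Cs -> flatten Bs = flatten Cs -> Bs = Cs.
Proof.
elim: Bs Cs => [|[|h t] Bs IH] [|[|g u] Cs] //.
rewrite /record_decomp /= -!andbA.
move=> /and4P[ht aB hB pB] /and4P[gu aC gC pC] [eh]; move: ht hB; rewrite {}eh => gt gB e.
(* The first block ends just before the first entry that is not below g. *)
have findE v Ds : all (fun z => z < g) v -> all record_block Ds ->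
    all (fun B => g < head 0 B) Ds ->
    find (fun z => ~~ (z < g)) (v ++ flatten Ds) = size v.
  move=> av rD gD; rewrite find_cat has_predC av /=.
  case: Ds rD gD => [|[|f D] Ds] //=; first by rewrite addn0.
  by move=> _ /andP[gf _]; rewrite ltNge ltW //= addn0.
have e1 := findE _ _ gt aB gB; have e2 := findE _ _ gu aC gC.
have sz : size t = size u by rewrite -e1 e e2.
have [-> e'] : t = u /\ flatten Bs = flatten Cs.
  by move/eqP: e; rewrite eqseq_cat // => /andP[/eqP-> /eqP->].
by rewrite (IH Cs) // /record_decomp ?aB ?aC.
Qed.

(** Every entry at an odd position, counted from 0, has a larger entry on its
left: left-to-right maxima occur at even positions only. *)
Definition odd_dominated (s : seq int) : bool :=
  all (fun i => odd i ==> has (fun j => nth 0 s i < nth 0 s j) (iota 0 i))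
    (iota 0 (size s)).

Lemma odd_dominatedP (s : seq int) :
  reflect (forall i, (i < size s)%N -> odd i ->
             exists2 j, (j < i)%N & nth 0 s i < nth 0 s j)
    (odd_dominated s).
Proof.
apply: (iffP allP) => H i.
  move=> ilt io; have := H i; rewrite mem_iota ilt io => /(_ isT)/hasP[j].
  by rewrite mem_iota /= => ji ltij; exists j.
rewrite mem_iota /= => ilt; apply/implyP => io; have [j ji ltij] := H i ilt io.
by apply/hasP; exists j => //; rewrite mem_iota.
Qed.

(** Splitting at the last left-to-right maximum h. *)
Lemma odd_dominated_cat (s t : seq int) (h : int) :
  all (fun v => v < h) s -> all (fun v => v < h) t ->
  odd_dominated (s ++ h :: t) = odd_dominated s && ~~ odd (size s).
Proof.
move=> sh th; apply/odd_dominatedP/andP => [H|[/odd_dominatedP H es] i].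
  split; last first.
    apply/negP => os; have [|//|j js] := H (size s).
      by rewrite size_cat /=; lia.
    rewrite !nth_cat ltnn subnn js /= ltNge ltW //.
    by apply: (allP sh); rewrite mem_nth.
  apply/odd_dominatedP => i ilt io.
  have [|//|j ji] := H i; first by rewrite size_cat; lia.
  by rewrite !nth_cat ilt (ltn_trans ji ilt); exists j.
rewrite size_cat /= => ilt io.
have [lti|] := ltnP i (size s).
  by have [j ji ltij] := H i lti io; exists j; rewrite // !nth_cat lti (ltn_trans ji lti).
rewrite leq_eqVlt => /orP[/eqP ei|gti]; first by rewrite -ei (negPf es) in io.
exists (size s) => //; rewrite !nth_cat ltnn subnn ltnNge ltnW //=.
have ilt' : ((i - size s).-1 < size t)%N by lia.
have -> : (i - size s = (i - size s).-1.+1)%N by lia.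
by rewrite /=; apply: (allP th); rewrite mem_nth.
Qed.

Lemma even_record_decomp (Bs : seq (seq int)) :
  record_decomp Bs ->
  all (fun B => ~~ odd (size B)) Bs
    = ~~ odd (size (flatten Bs)) && odd_dominated (flatten Bs).
Proof.
elim/last_ind: Bs => [//|Bs B IH].
rewrite /record_decomp all_rcons pairwise_rcons => /andP[/andP[rB aB] /andP[hB pB]].
rewrite all_rcons flatten_rcons.
case: B rB hB => // h t th hB.
rewrite odd_dominated_cat //; last first.
  apply/allP => v /flattenP[D DBs vD].
  have := allP hB D DBs; have := allP aB D DBs.
  case: D {DBs} vD => // f D; rewrite inE /= => /predU1P[->//|vD] /allP/(_ v vD) vf fh.
  exact: lt_trans vf fh.
rewrite IH ?/record_decomp ?aB // size_cat /= oddD /=.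
by case: (odd (size (flatten Bs))); case: (odd (size t)); rewrite ?andbF ?andbT.
Qed.

Section PhiBij.
Variable T : {fset int}.
Implicit Type sigma : {perm T}.

(** The cycle words whose concatenation is Phi sigma. *)
Definition blocks sigma := [seq cycle_word sigma x | x <- cycle_maxima sigma].

Lemma mem_cycle_maxima sigma x :
  reflect (forall y, y \in porbit sigma x -> val y <= val x)
    (x \in cycle_maxima sigma).
Proof.
rewrite mem_sort mem_filter mem_enum andbT.
exact: forall_inP.
Qed.

Lemma size_cycle_word sigma x : size (cycle_word sigma x) = #|porbit sigma x|.
Proof. by rewrite size_map size_traject. Qed.

Lemma cycle_wordE sigma x :
  exists u, traject sigma x #|porbit sigma x| = x :: u.
Proof.
have : (0 < #|porbit sigma x|)%N by apply/card_gt0P; exists x; apply: porbit_id.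
by case: #|_| => // k _; exists (traject sigma (sigma x) k).
Qed.

(** The blocks of Phi sigma can thus be read off from the word alone, which
makes Phi injective. *)
Lemma record_decomp_blocks sigma : record_decomp (blocks sigma).
Proof.
have headE x : head 0 (cycle_word sigma x) = val x.
  by rewrite /cycle_word; have [u ->] := cycle_wordE sigma x.
apply/andP; split.
  apply/allP => _ /mapP[x xm ->]; rewrite /cycle_word.
  have := uniq_traject_porbit sigma x; have := porbit_traject sigma x.
  have [u ->] := cycle_wordE sigma x => pu /= /andP[xu _].
  apply/allP => _ /mapP[y yu ->]; rewrite lt_neqAle.
  have /mem_cycle_maxima-> := xm; last by rewrite pu inE yu orbT.
  by rewrite andbT (inj_eq val_inj); apply: contraNneq xu => <-.
rewrite pairwise_map.
have -> : pairwise (relpre (cycle_word sigma) (fun B B' => head 0 B < head 0 B'))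
    (cycle_maxima sigma) = pairwise (relpre val <%R) (cycle_maxima sigma).
  by apply: eq_pairwise => x y /=; rewrite !headE.
rewrite -pairwise_map -sorted_pairwise; last exact: lt_trans.
rewrite lt_sorted_uniq_le map_inj_uniq; last exact: val_inj.
rewrite sort_uniq filter_uniq ?enum_uniq //= sorted_map.
by apply: sort_sorted => x y /=; apply: le_total.
Qed.

Lemma cycle_maximum sigma y :
  exists2 c, c \in cycle_maxima sigma & y \in porbit sigma c.
Proof.
have := @arg_maxP _ _ _ y (mem (porbit sigma y)) val (porbit_id _ _).
case=> c cy cmax; exists c; last by rewrite porbit_sym.
apply/mem_cycle_maxima => z.
have /eqP-> : porbit sigma c == porbit sigma y by rewrite eq_porbit_mem.
exact: cmax.
Qed.

Lemma Phi_inj : injective (@Phi T).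
Proof.
move=> sigma tau e; apply/permP => y.
have {}e : blocks sigma = blocks tau.
  by apply: record_decomp_inj e; apply: record_decomp_blocks.
have [c cm yc] := cycle_maximum sigma y.
have : cycle_word sigma c \in blocks tau by rewrite -e map_f.
case/mapP=> d _ ecd.
have sz : #|porbit sigma c| = #|porbit tau d| by rewrite -!size_cycle_word ecd.
have {ecd} := inj_map val_inj ecd => etr.
have ecd : c = d.
  have [u eu] := cycle_wordE sigma c; have [v ev] := cycle_wordE tau d.
  by move: etr; rewrite eu ev => -[].
rewrite -{d}ecd in sz etr.
move: yc; rewrite porbit_traject => /trajectP[i im ->].
have nthE j : (j < #|porbit sigma c|)%N -> iter j sigma c = iter j tau c.
  by move=> jm; rewrite -(nth_traject sigma jm) etr nth_traject // -sz.
rewrite [in RHS](nthE _ im) -[LHS]iterS -[RHS]iterS.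
have [lt|] := ltnP i.+1 #|porbit sigma c|; first exact: nthE.
move=> ge; have -> : i.+1 = #|porbit sigma c| by lia.
by rewrite iter_porbit sz iter_porbit.
Qed.

Lemma perm_Phi sigma : perm_eq (Phi sigma) (enum_fset T).
Proof.
apply: uniq_perm; first 1 last.
- exact: fset_uniq.
- move=> v; apply/flattenP/idP => [[_ /mapP[c _ ->] /mapP[y _ ->]]|vT]; first exact: valP.
  have [c cm yc] := cycle_maximum sigma [` vT]%fset.
  exists (cycle_word sigma c); first exact: map_f.
  by apply/mapP; exists [` vT]%fset; rewrite -?porbit_traject.
apply: (@allpairs_uniq_dep T (fun=> T) int (fun=> val)
   (cycle_maxima sigma) (fun x => traject sigma x #|porbit sigma x|)).
- by rewrite sort_uniq filter_uniq ?enum_uniq.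
- by move=> x _; apply: uniq_traject_porbit.
move=> _ _ /allpairsPdep[c [y [cm yc ->]]] /allpairsPdep[d [z [dm zd ->]]] /=.
move=> /val_inj yz; rewrite -{z}yz -porbit_traject in zd *.
rewrite -porbit_traject in yc; suff -> : c = d by [].
have cd : porbit sigma c = porbit sigma d.
  by move: yc zd; rewrite -!eq_porbit_mem => /eqP<- /eqP<-.
apply/val_inj/le_anti/andP; split.
  by move/mem_cycle_maxima: dm; apply; rewrite -cd porbit_id.
by move/mem_cycle_maxima: cm; apply; rewrite cd porbit_id.
Qed.

Lemma even_cyclesE sigma :
  even_cycles sigma = ~~ odd #|` T| && odd_dominated (Phi sigma).
Proof.
have szP : size (flatten (blocks sigma)) = #|` T|.
  by rewrite (perm_size (perm_Phi sigma)).
rewrite -szP -[Phi sigma]/(flatten (blocks sigma)) -even_record_decomp; last first.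
  exact: record_decomp_blocks.
rewrite all_map; apply/forall_inP/allP => [H c _|H C /imsetP[y _ ->]].
  by rewrite /= size_cycle_word; apply: H; apply: imset_f.
have [c cm yc] := cycle_maximum sigma y.
have /eqP-> : porbit sigma y == porbit sigma c by rewrite eq_porbit_mem.
by rewrite -size_cycle_word; apply: H.
Qed.

End PhiBij.

(** Surjectivity of Phi follows from injectivity by counting: a word of size m
without repetition has m! rearrangements. *)
Lemma Phi_invK (s : seq int) : uniq s -> Phi (Phi_inv s) = s.
Proof.
move=> us; rewrite /Phi_inv; case: pickP => [sigma /eqP //|noPhi].
set T := [fset v in s]%fset in noPhi *.
have Ts : perm_eq (enum_fset T) s.
  by apply: uniq_perm => // v; rewrite ?fset_uniq //; apply: in_fset.
pose X := [seq Phi sigma | sigma : {perm T}].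
have uX : uniq X by rewrite map_inj_uniq ?enum_uniq //; apply: Phi_inj.
have XS : {subset X <= permutations s}.
  move=> _ /mapP[sigma _ ->]; rewrite mem_permutations.
  exact: perm_trans (perm_Phi sigma) Ts.
have szX : (size (permutations s) <= size X)%N.
  rewrite size_permutations // size_map -cardE -(perm_size Ts).
  rewrite -[size _]/#|`T| cardfE -cardsT -card_perm subset_leq_card //.
  by apply/subsetP => sigma _; rewrite inE.
have [_ XE] := uniq_min_size uX XS szX.
have : s \in X by rewrite XE mem_permutations.
by case/mapP => sigma _ es; have := noPhi sigma; rewrite -es eqxx.
Qed.

Lemma even_cycles_Phi_inv (s : seq int) : uniq s ->
  even_cycles (Phi_inv s) = ~~ odd (size s) && odd_dominated s.
Proof.
move=> us; rewrite even_cyclesE Phi_invK //; congr (~~ odd _ && _).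
by rewrite card_fseq undup_id.
Qed.

(** * The watershed as a system of conditions on windows *)

(** With positions and pairs counted from 0, the pair c consists of the
positions 2c and 2c+1.  For k to be the watershed, the entry at [bad_pos k c]
must not be the maximum of the window of positions from [window_lo k c]
(included) to [window_hi k c] (excluded). *)
Definition bad_pos (k c : nat) : nat := if (c < k)%N then c.*2 else c.*2.+1.

Definition window_lo (k c : nat) : nat := if (c < k)%N then c.*2 else k.*2.
Definition window_hi (k c : nat) : nat := if (c < k)%N then k.*2 else c.*2.+2.

Lemma watershed_atP (s : seq int) (n k : nat) :
  uniq s -> size s = n.*2 -> (k <= n)%N ->
  reflect (forall c, (c < n)%N ->
     exists2 j, (window_lo k c <= j < window_hi k c)%N
              & nth 0 s (bad_pos k c) < nth 0 s j)
    (watershed_at s k).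
Proof.
move=> us szs kn.
have szt : size (take k.*2 s) = k.*2 by rewrite size_takel // szs leq_double.
have szd : size (drop k.*2 s) = (n - k).*2 by rewrite size_drop szs -doubleB.
rewrite /watershed_at !even_cycles_Phi_inv ?rev_uniq ?take_uniq ?drop_uniq //.
rewrite size_rev szt szd !odd_double /=.
have nth_rt i : (i < k.*2)%N -> nth 0 (rev (take k.*2 s)) i = nth 0 s (k.*2 - i.+1).
  by move=> ik; rewrite nth_rev szt // nth_take //; lia.
apply: (iffP andP) => [[/odd_dominatedP Hl /odd_dominatedP Hr] c cn|H].
  rewrite /window_lo /window_hi /bad_pos; case: (ltnP c k) => ck.
    have [||j jlt] := Hl (k.*2 - c.*2.+1)%N.
    - by rewrite size_rev szt; lia.
    - by lia.
    rewrite !nth_rt; [|lia|lia] => ltj.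
    exists (k.*2 - j.+1)%N; first by lia.
    by rewrite [c.*2](_ : _ = (k.*2 - (k.*2 - c.*2.+1).+1)%N) //; lia.
  have [||j jlt] := Hr (c.*2.+1 - k.*2)%N; [by rewrite szd; lia|by lia|].
  rewrite !nth_drop => ltj; exists (k.*2 + j)%N; first by lia.
  by rewrite [c.*2.+1](_ : _ = (k.*2 + (c.*2.+1 - k.*2))%N) //; lia.
split; apply/odd_dominatedP => i.
  rewrite size_rev szt => ik io.
  have [|j] := H (k - i.+1./2)%N; first by lia.
  rewrite /window_lo /window_hi /bad_pos !ifT; try lia.
  move=> jb ltj; have jN : j <> (k - i.+1./2).*2 by move=> ej; rewrite ej ltxx in ltj.
  exists (k.*2 - j.+1)%N; first by lia.
  rewrite !nth_rt; [|lia|lia].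
  rewrite (_ : (k.*2 - i.+1)%N = (k - i.+1./2).*2); last by lia.
  by rewrite (_ : (k.*2 - (k.*2 - j.+1).+1)%N = j) //; lia.
rewrite szd => ik io.
have [|j] := H (k + i./2)%N; first by lia.
rewrite /window_lo /window_hi /bad_pos !ifF; try lia.
move=> jb ltj.
have jN : j <> (k + i./2).*2.+1 by move=> ej; rewrite ej ltxx in ltj.
exists (j - k.*2)%N; first by lia.
rewrite !nth_drop (_ : (k.*2 + i)%N = (k + i./2).*2.+1); last by lia.
by rewrite (_ : (k.*2 + (j - k.*2))%N = j) //; lia.
Qed.

(** The maximum of the entries at positions in [2j, 2k) breaks a condition of j
or one of k, depending on the parity of its position. *)
Lemma watershed_at_inj (s : seq int) (n j k : nat) :
  uniq s -> size s = n.*2 -> (j < k)%N -> (k <= n)%N ->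
  watershed_at s j -> watershed_at s k -> False.
Proof.
move=> us szs jk kn.
move=> /(watershed_atP us szs (leq_trans (ltnW jk) kn)) Hj.
move=> /(watershed_atP us szs kn) Hk.
have j2n : (j.*2 < n.*2)%N by lia.
pose P (i : 'I_n.*2) := (j.*2 <= i < k.*2)%N.
have P0 : P (Ordinal j2n) by rewrite /P /=; lia.
case: (arg_maxP (fun i : 'I_n.*2 => nth 0 s i) P0) => M PM Mmax.
rewrite /P in PM.
have noM l : (j.*2 <= l < k.*2)%N -> nth 0 s M < nth 0 s l -> False.
  move=> lP; have ln : (l < n.*2)%N by lia.
  by apply/negP; rewrite -leNgt; apply: (Mmax (Ordinal ln)).
have Mn : (M./2 < n)%N by lia.
case: (boolP (odd M)) => oM.
  have [l] := Hj _ Mn; rewrite /window_lo /window_hi /bad_pos !ifF; try lia.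
  by rewrite (_ : M./2.*2.+1 = M); [move=> lb; apply: noM; lia|lia].
have [l] := Hk _ Mn; rewrite /window_lo /window_hi /bad_pos !ifT; try lia.
by rewrite (_ : M./2.*2 = M); [move=> lb; apply: noM; lia|lia].
Qed.

Lemma watershed_eq (s : seq int) (n k : nat) :
  uniq s -> size s = n.*2 -> (k <= n)%N -> (watershed s == k) = watershed_at s k.
Proof.
move=> us szs kn; rewrite /watershed szs doubleK.
set r := iota 0 n.+1.
have nthr i : (i <= n)%N -> nth 0 r i = i by move=> i_n; rewrite nth_iota.
apply/eqP/idP => [fk|wk].
  have hs : has (watershed_at s) r by rewrite has_find fk size_iota.
  by have := nth_find 0 hs; rewrite fk nthr.
have hs : has (watershed_at s) r by apply/hasP; exists k; rewrite // mem_iota.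
have fle : (find (watershed_at s) r <= k)%N.
  rewrite leqNgt; apply/negP => kf; have := before_find 0 kf.
  by rewrite nthr // wk.
have := nth_find 0 hs; rewrite nthr ?(leq_trans fle) // => wf.
move: fle; rewrite leq_eqVlt => /orP[/eqP //|flt].
by case: (watershed_at_inj us szs flt kn wf wk).
Qed.

Lemma pairwise_rev (T : Type) (r : rel T) (s : seq T) :
  pairwise r (rev s) = pairwise (fun y z => r z y) s.
Proof. by elim: s => //= y s IH; rewrite rev_cons pairwise_rcons all_rev IH. Qed.

(** * The law of the watershed for positive weights *)

Section GeneralWeights.
Variables (R : realFieldType) (w : nat -> R) (n k : nat).
Hypothesis w_gt0 : forall i, (i < n.*2)%N -> 0 < w i.+1.
Hypothesis kn : (k <= n)%N.

(** Total weight of the positions lo, ..., hi - 1, counted from 0. *)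
Definition range_weight (lo hi : nat) : R := \sum_(lo <= i < hi) w i.+1.

Lemma bad_pos_lt (c : 'I_n) : (bad_pos k c < n.*2)%N.
Proof. by have := ltn_ord c; rewrite /bad_pos; case: ifP; lia. Qed.

Definition bad_ord (c : 'I_n) : 'I_n.*2 := Ordinal (bad_pos_lt c).

Definition window (c : 'I_n) : {set 'I_n.*2} :=
  [set j : 'I_n.*2 | window_lo k c <= j < window_hi k c]%N.

Lemma total_weight_range lo hi : (hi <= n.*2)%N ->
  total_weight w [set j : 'I_n.*2 | lo <= j < hi]%N = range_weight lo hi.
Proof.
move=> hin; rewrite /total_weight /range_weight.
rewrite (big_nat_widen _ _ _ _ _ hin) (big_nat_widenl _ 0) // big_mkord.
by apply: eq_bigl => j; rewrite inE andbC.
Qed.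

Lemma avoid_prob_left (c : 'I_n) : (c < k)%N ->
  avoid_prob bad_ord window w c
    = range_weight c.*2.+1 k.*2 / range_weight c.*2 k.*2.
Proof.
move=> ck; rewrite /avoid_prob -!total_weight_range ?leq_double //.
congr (_ / _); (congr (total_weight w _); apply/setP => j;
  rewrite !inE /window_lo /window_hi ck //).
by rewrite -val_eqE /= /bad_pos ck; lia.
Qed.

Lemma avoid_prob_right (c : 'I_n) : (k <= c)%N ->
  avoid_prob bad_ord window w c
    = range_weight k.*2 c.*2.+1 / range_weight k.*2 c.*2.+2.
Proof.
move=> kc; have cn := ltn_ord c.
rewrite /avoid_prob -!total_weight_range; [|lia|lia].
congr (_ / _); (congr (total_weight w _); apply/setP => j;
  rewrite !inE /window_lo /window_hi ltnNge kc //).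
by rewrite -val_eqE /= /bad_pos ltnNge kc /=; lia.
Qed.

(** The pairs, in an order that lists larger windows first in
both chains of nested windows. *)
Definition pair_order : seq 'I_n :=
  [seq c : 'I_n <- enum 'I_n | (c < k)%N]
    ++ rev [seq c : 'I_n <- enum 'I_n | (k <= c)%N].

Lemma laminar_pair_order : pairwise (laminar bad_ord window) pair_order.
Proof.
have lamP (c d : 'I_n) :
    (c < k)%N && ((c < d)%N || (k <= d)%N) || [&& k <= c, k <= d & d < c]%N ->
    laminar bad_ord window c d.
  move=> H; apply/andP; split.
    by rewrite inE /= /bad_pos /window_lo /window_hi;
      have [ck|kc] := ltnP c k; have [dk|kd] := ltnP d k; lia.
  have [dk|kd] := ltnP d k.
    apply/orP; left; apply/subsetP => j; rewrite !inE /window_lo /window_hi dk.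
    by rewrite !ifT; lia.
  have [ck|kc] := ltnP c k.
    apply/orP; right; apply/pred0P => j; rewrite /= !inE /window_lo /window_hi ck.
    by rewrite ltnNge kd /=; lia.
  apply/orP; left; apply/subsetP => j; rewrite !inE /window_lo /window_hi.
  by rewrite !ltnNge kd kc /=; lia.
have ltn_enum (p : pred 'I_n) :
    pairwise (fun c d : 'I_n => (c < d)%N) [seq c <- enum 'I_n | p c].
  apply: pairwise_filter; have := iota_ltn_sorted 0 n.
  by rewrite -val_enum_ord (sorted_pairwise ltn_trans) pairwise_map.
rewrite /pair_order pairwise_cat; apply/and3P; split.
- apply/allrelP => c d; rewrite mem_rev !mem_filter => /andP[ck _] /andP[kd _].
  by apply: lamP; lia.
- apply: sub_in_pairwise (filter_all _ _) (ltn_enum _) => c d.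
  by rewrite -!topredE /= => ck dk cd; apply: lamP; rewrite ck cd.
rewrite pairwise_rev; apply: sub_in_pairwise (filter_all _ _) (ltn_enum _) => c d.
by rewrite -!topredE /= => kc kd cd; apply: lamP; apply/orP; right; rewrite kd kc cd.
Qed.

Lemma prod_pair_order (F : nat -> R) :
  \prod_(c <- pair_order) F c
    = (\prod_(0 <= c < k) F c) * \prod_(k <= c < n) F c.
Proof.
rewrite big_cat (perm_big _ (permEl (perm_rev _))) !big_filter !big_enum_cond /=.
congr (_ * _).
  by rewrite (big_nat_widen _ _ _ _ _ kn) big_mkord.
by rewrite (big_nat_widenl _ 0) // big_mkord.
Qed.

Lemma watershed_at_avoids (s : seq int) :
  uniq s -> size s = n.*2 ->
  watershed_at s k = all (avoids bad_ord window s) pair_order.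
Proof.
move=> us szs; apply/(watershed_atP us szs kn)/allP => [H c _|H c cn].
  have [j jc ltj] := H c (ltn_ord c); apply/existsP.
  have jn : (j < n.*2)%N.
    by move: jc (ltn_ord c); rewrite /window_lo /window_hi; case: ifP; lia.
  by exists (Ordinal jn); rewrite inE jc.
have : Ordinal cn \in pair_order.
  have memE (p : pred 'I_n) :
      (Ordinal cn \in [seq d : 'I_n <- enum 'I_n | p d]) = p (Ordinal cn).
    by rewrite mem_filter mem_enum andbT.
  by rewrite /pair_order mem_cat mem_rev !memE /=; case: ltnP.
by move=> /H/existsP[j]; rewrite inE => /andP[jc ltj]; exists j.
Qed.

Lemma window_bad (c : 'I_n) : bad_ord c \in window c.
Proof. by rewrite inE /= /bad_pos /window_lo /window_hi; case: ifP; lia. Qed.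

(** The law of the watershed for arbitrary positive weights. *)
Lemma watershed_prob (S : {fset int}) : #|` S| = n.*2 ->
  processW_prob S w (fun s => watershed s == k)
    = \prod_(0 <= c < k) (range_weight c.*2.+1 k.*2 / range_weight c.*2 k.*2)
      * \prod_(k <= c < n) (range_weight k.*2 c.*2.+1 / range_weight k.*2 c.*2.+2).
Proof.
move=> cardS; rewrite /processW_prob /processW.
have szS : size (enum_fset S) = n.*2 by rewrite -cardS.
rewrite cardS.
transitivity (\sum_(s <- permutations (enum_fset S)
                    | all (avoids bad_ord window s) pair_order)
   @fill_law R w n.*2 [ffun=> None] (sort >=%O (enum_fset S)) s).
  rewrite big_seq_cond [RHS]big_seq_cond; apply: eq_bigl => s.
  rewrite mem_permutations; case: (boolP (perm_eq s _)) => //= ps.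
  have us : uniq s by rewrite (perm_uniq ps) fset_uniq.
  have szs : size s = n.*2 by rewrite (perm_size ps).
  by rewrite (watershed_eq us szs kn) watershed_at_avoids.
have filled0 : filled [ffun=> None : option int] = set0 :> {set 'I_n.*2}.
  by apply/setP => i; rewrite !inE ffunE.
rewrite (fill_law_prob window_bad w_gt0 laminar_pair_order); first 1 last.
- rewrite -rev_sorted lt_sorted_uniq_le rev_sorted rev_uniq sort_uniq fset_uniq /=.
  by apply: sort_sorted => y z; apply: le_total.
- by rewrite size_sort szS filled0 setC0 cardsT card_ord.
- by move=> i u; rewrite ffunE.
- have -> : pmap id (codom ([ffun=> None] : {ffun 'I_n.*2 -> option int})) = [::].
    rewrite codomE; elim: (enum _) => //= i s IH; rewrite ffunE.
    exact: IH.
  by rewrite perm_sym perm_sort.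
pose F c := if (c < k)%N then range_weight c.*2.+1 k.*2 / range_weight c.*2 k.*2
  else range_weight k.*2 c.*2.+1 / range_weight k.*2 c.*2.+2.
transitivity (\prod_(c <- pair_order) F c).
  apply: eq_bigr => c _; rewrite /factor /respects ffunE mul1r filled0.
  rewrite disjoints_subset setC0 subsetT /F; case: ltnP => [|].
    exact: avoid_prob_left.
  exact: avoid_prob_right.
rewrite prod_pair_order; congr (_ * _); apply: eq_big_nat => c /andP[kc ck]; rewrite /F.
  by rewrite ck.
by rewrite ltnNge kc.
Qed.
End GeneralWeights.

(** * The q-weights *)

Section QWeights.
Variables (R : realFieldType) (q : R) (a b : nat -> nat).
Hypothesis q_gt0 : 0 < q.

Lemma qint_gt0 m : (0 < m)%N -> 0 < qint q m.
Proof.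
case: m => // m _; rewrite /qint big_ord_recl expr0 ltr_wpDr //.
by apply: sumr_ge0 => i _; rewrite exprn_ge0 // ltW.
Qed.

Lemma sum_expr_qint lo m :
  \sum_(t < m) q ^+ (lo + t) = q ^+ lo * qint q m.
Proof. by rewrite /qint mulr_sumr; apply: eq_bigr => t _; rewrite exprD. Qed.

Lemma qintD l m : qint q (l + m) = qint q l + q ^+ l * qint q m.
Proof. by rewrite -sum_expr_qint /qint big_split_ord. Qed.

Definition block_sum (i j : nat) : nat := \sum_(i <= l < j) (a l + b l)%N.

(** The weight of the position l, counted from 0, is the sum of q ^+ t over
offset l <= t < offset l + part_length l ([weightE]). *)
Definition offset (l : nat) : nat :=
  (block_sum 1 l./2.+1 + if odd l then a l./2.+1 else 0)%N.

Definition part_length (l : nat) : nat :=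
  if odd l then b l./2.+1 else a l./2.+1.

Lemma offsetS l : offset l.+1 = (offset l + part_length l)%N.
Proof.
rewrite /offset /part_length /= uphalf_half.
case: (odd l); rewrite /= ?add0n ?add1n ?addn0 // /block_sum.
by rewrite big_nat_recr //= addnA.
Qed.

Lemma weightE l : weight q a b l.+1 = q ^+ offset l * qint q (part_length l).
Proof.
rewrite /weight /offset /part_length /= -/(block_sum _ _).
by case: (odd l); rewrite /= ?addn0 sum_expr_qint.
Qed.

Lemma leq_offset lo hi : (lo <= hi)%N -> (offset lo <= offset hi)%N.
Proof.
move=> /subnKC <-; elim: (hi - lo)%N => [|d IH]; first by rewrite addn0.
by rewrite addnS offsetS (leq_trans IH) ?leq_addr.
Qed.

Lemma range_weightE lo hi : (lo <= hi)%N ->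
  range_weight (weight q a b) lo hi
    = q ^+ offset lo * qint q (offset hi - offset lo).
Proof.
move=> /subnKC <-; elim: (hi - lo)%N => [|d IH].
  by rewrite addn0 subnn /range_weight big_geq // /qint big_ord0 mulr0.
rewrite addnS /range_weight big_nat_recr ?leq_addr //= -/(range_weight _ _ _) IH.
have le := leq_offset (leq_addr d lo).
rewrite weightE offsetS -addnBAC // qintD mulrDr; congr (_ + _).
by rewrite mulrA -exprD subnKC.
Qed.

Lemma offset_double i j : (i <= j)%N ->
  offset j.*2 = (offset i.*2 + block_sum i.+1 j.+1)%N.
Proof.
by move=> ij; rewrite /offset !odd_double !addn0 !doubleK -big_cat_nat.
Qed.

Lemma offset_doubleS i : offset i.*2.+1 = (offset i.*2 + a i.+1)%N.
Proof. by rewrite offsetS /part_length odd_double doubleK. Qed.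

Lemma varphiE n k :
  varphi q a b n k
    = \prod_(0 <= c < k) (range_weight (weight q a b) c.*2.+1 k.*2
                           / range_weight (weight q a b) c.*2 k.*2)
      * \prod_(k <= c < n) (range_weight (weight q a b) k.*2 c.*2.+1
                             / range_weight (weight q a b) k.*2 c.*2.+2).
Proof.
have qX l : q ^+ l != 0 by rewrite expf_neq0 // gt_eqF.
have factE l x y : q ^+ l * x / (q ^+ l * y) = x / y.
  by rewrite invfM mulrACA divff // mul1r.
rewrite /varphi !big_add1; congr (_ * _); apply: eq_big_nat => c /andP[kc ck].
  rewrite !range_weightE; [|by lia|by lia].
  rewrite offset_doubleS exprD -(mulrA (q ^+ offset c.*2)) factE.
  rewrite (offset_double (ltnW ck)) addKn.
  have blockE : block_sum c.+1 k.+1 = (a c.+1 + (b c.+1 + block_sum c.+2 k.+1))%N.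
    by rewrite /block_sum big_ltn // addnA.
  by rewrite {1}blockE subnDl addKn.
rewrite !range_weightE; [|by lia|by lia].
rewrite factE -doubleS offset_doubleS (offset_double kc) (offset_double (leqW kc)).
by rewrite -addnA !addKn addnC.
Qed.
End QWeights.

Theorem theorem2 (R : realFieldType) (n : nat) (q : R) (a b : nat -> nat)
    (S : {fset int}) (k : nat) :
  (1 <= n)%N ->
  0 < q ->
  (forall i : nat, (1 <= i <= n)%N -> (0 < a i)%N) ->
  (forall i : nat, (1 <= i <= n)%N -> (0 < b i)%N) ->
  #|` S|%fset = (2 * n)%N ->
  (k <= n)%N ->
  processW_prob S (weight q a b) (fun s => watershed s == k)
    = varphi q a b n k.
Proof.
move=> _ q0 a0 b0 cardS kn.
rewrite (watershed_prob (n := n)) ?varphiE // -?mul2n // => i iln.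
rewrite weightE mulr_gt0 ?exprn_gt0 // qint_gt0 // /part_length.
by case: ifP => _; [apply: b0|apply: a0]; lia.
Qed.
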